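(* Let $E$ be an arbitrary graph and $K$ a field with involution. The following are equivalent: (1) $L_K(E)$ is directly finite; (2) $L_K(E)$ is finite; (3) $E$ is no-exit.
   Context: A (directed) graph $E=(E^0,E^1,\mathbf{s},\mathbf{r})$ has vertex set $E^0$, edge set $E^1$, source and range maps; no finiteness or countability is assumed. A path is a vertex or a sequence $e_1\cdots e_n$ of edges with $\mathbf{r}(e_i)=\mathbf{s}(e_{i+1})$. A cycle is a path $e_1\cdots e_n$ ($n\ge1$) with $\mathbf{s}(e_1)=\mathbf{r}(e_n)$ and $\mathbf{s}(e_i)\ne\mathbf{s}(e_j)$ for $i\ne j$; $E$ is no-exit if $\mathbf{s}^{-1}(v)$ has exactly one element for every vertex $v$ lying on a cycle. A vertex $v$ is regular if $\mathbf{s}^{-1}(v)$ is nonempty and finite. $K$ has an arbitrary involution. $L_K(E)$ is the free $K$-algebra generated by $E^0\cup E^1\cup\{e^*:e\in E^1\}$ subject to (V) $vw=\delta_{v,w}v$; (E1) $\mathbf{s}(e)e=e\mathbf{r}(e)=e$; (E2) $\mathbf{r}(e)e^*=e^*\mathbf{s}(e)=e^*$; (CK1) $e^*f=\delta_{e,f}\mathbf{r}(e)$; (CK2) $v=\sum_{e\in\mathbf{s}^{-1}(v)}ee^*$ for regular $v$; it has involution $(\sum a_ip_iq_i^* )^*=\sum a_i^*q_ip_i^*$ (with $p^*=e_n^*\cdots e_1^*$, $v^*=v$) and has local units. A ring with local units is directly finite if for all $x,y$ and every idempotent $u$ with $xu=ux=x$, $yu=uy=y$, $xy=u$ implies $yx=u$;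 a $*$-ring with local units is finite if for all $x$ and every idempotent $u$ with $xu=ux=x$, $xx^*=u$ implies $x^*x=u$. *)

(* Defs.v *)
From HB Require Import structures.
From mathcomp Require Import all_boot all_order all_algebra.
From Stdlib Require Import List.
Set Implicit Arguments.
Unset Strict Implicit.
Unset Printing Implicit Defensive.
Import GRing.Theory.
Local Open Scope ring_scope.

(* A graph E = (V, Ed, s, r): vertex type V, edge type Ed, source s, range r.
   No finiteness / countability / decidability assumptions. *)

Section LeavittPathAlgebra.
Variables (K : fieldType) (sigma : K -> K).
Variables (V Ed : Type) (s r : Ed -> V).

Fixpoint path_from (e : Ed) (l : list Ed) : Prop :=
  match l with
  | nil => True
  | f :: l' => r e = s f /\ path_from f l'
  end.

Definition is_cycle (c : list Ed) : Prop :=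
  exists e l, c = e :: l /\ path_from e l /\ s e = r (last l e)
              /\ NoDup (List.map s c).

Definition on_cycle (v : V) : Prop :=
  exists c, is_cycle c /\ exists e, In e c /\ s e = v.

Definition no_exit : Prop :=
  forall v, on_cycle v -> exists e, s e = v /\ forall f, s f = v -> f = e.

Inductive gen : Type :=
  | GV of V
  | GE of Ed
  | GG of Ed.      (* ghost edge e^* *)

Inductive term : Type :=
  | tgen of gen
  | tzero
  | tadd of term & term
  | tscale of K & term
  | tmul of term & term.

Definition tsum_ghost (l : list Ed) : term :=
  foldr (fun e acc => tadd (tmul (tgen (GE e)) (tgen (GG e))) acc) tzero l.

(* [lpa_eq x y] : x and y are equal in L_K(E), i.e. the smallest congruence
   on terms containing the axioms of an associative K-algebra (without unit)
   and the relations (V), (E1), (E2), (CK1), (CK2).  The quotient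
   term / lpa_eq is the free K-algebra modulo the ideal generated by the
   relations, i.e. L_K(E). *)
Inductive lpa_eq : term -> term -> Prop :=
  | eq_refl x : lpa_eq x x
  | eq_sym x y : lpa_eq x y -> lpa_eq y x
  | eq_trans x y z : lpa_eq x y -> lpa_eq y z -> lpa_eq x z
  | eq_add x x' y y' : lpa_eq x x' -> lpa_eq y y' -> lpa_eq (tadd x y) (tadd x' y')
  | eq_scale a x x' : lpa_eq x x' -> lpa_eq (tscale a x) (tscale a x')
  | eq_mul x x' y y' : lpa_eq x x' -> lpa_eq y y' -> lpa_eq (tmul x y) (tmul x' y')
  | ax_addA x y z : lpa_eq (tadd x (tadd y z)) (tadd (tadd x y) z)
  | ax_addC x y : lpa_eq (tadd x y) (tadd y x)
  | ax_add0 x : lpa_eq (tadd x tzero) x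
  | ax_addN x : lpa_eq (tadd x (tscale (-1) x)) tzero
  | ax_scale1 x : lpa_eq (tscale 1 x) x
  | ax_scaleA a b x : lpa_eq (tscale a (tscale b x)) (tscale (a * b) x)
  | ax_scaleDr a x y : lpa_eq (tscale a (tadd x y)) (tadd (tscale a x) (tscale a y))
  | ax_scaleDl a b x : lpa_eq (tscale (a + b) x) (tadd (tscale a x) (tscale b x))
  | ax_mulA x y z : lpa_eq (tmul x (tmul y z)) (tmul (tmul x y) z)
  | ax_mulDl x y z : lpa_eq (tmul (tadd x y) z) (tadd (tmul x z) (tmul y z))
  | ax_mulDr x y z : lpa_eq (tmul x (tadd y z)) (tadd (tmul x y) (tmul x z))
  | ax_scale_mull a x y : lpa_eq (tmul (tscale a x) y) (tscale a (tmul x y))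
  | ax_scale_mulr a x y : lpa_eq (tmul x (tscale a y)) (tscale a (tmul x y))
  | rel_V_eq v : lpa_eq (tmul (tgen (GV v)) (tgen (GV v))) (tgen (GV v))
  | rel_V_neq v w : v <> w -> lpa_eq (tmul (tgen (GV v)) (tgen (GV w))) tzero
  | rel_E1s e : lpa_eq (tmul (tgen (GV (s e))) (tgen (GE e))) (tgen (GE e))
  | rel_E1r e : lpa_eq (tmul (tgen (GE e)) (tgen (GV (r e)))) (tgen (GE e))
  | rel_E2r e : lpa_eq (tmul (tgen (GV (r e))) (tgen (GG e))) (tgen (GG e))
  | rel_E2s e : lpa_eq (tmul (tgen (GG e)) (tgen (GV (s e)))) (tgen (GG e))
  | rel_CK1_eq e : lpa_eq (tmul (tgen (GG e)) (tgen (GE e))) (tgen (GV (r e)))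
  | rel_CK1_neq e f : e <> f -> lpa_eq (tmul (tgen (GG e)) (tgen (GE f))) tzero
  (* (CK2): v regular, i.e. s^{-1}(v) is nonempty and finite, enumerated
     without repetition by the list l *)
  | rel_CK2 v (l : list Ed) :
      l <> nil -> NoDup l -> (forall e, In e l <-> s e = v) ->
      lpa_eq (tgen (GV v)) (tsum_ghost l).

(* the involution on L_K(E): (sum a_i p_i q_i^star)^star = sum a_i^* q_i p_i^*,
   i.e. v^star = v, e <-> e^star, (a x)^star = a^star x^star, (x y)^star = y^star x^star. *)
Fixpoint tstar (x : term) : term :=
  match x with
  | tgen (GV v) => tgen (GV v)
  | tgen (GE e) => tgen (GG e)
  | tgen (GG e) => tgen (GE e)
  | tzero => tzero
  | tadd x y => tadd (tstar x) (tstar y)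
  | tscale a x => tscale (sigma a) (tstar x)
  | tmul x y => tmul (tstar y) (tstar x)
  end.

(* directly finite (ring with local units) *)
Definition lpa_directly_finite : Prop :=
  forall x y u : term,
    lpa_eq (tmul u u) u ->
    lpa_eq (tmul x u) x -> lpa_eq (tmul u x) x ->
    lpa_eq (tmul y u) y -> lpa_eq (tmul u y) y ->
    lpa_eq (tmul x y) u -> lpa_eq (tmul y x) u.

(* finite (star-ring with local units) *)
Definition lpa_finite : Prop :=
  forall x u : term,
    lpa_eq (tmul u u) u ->
    lpa_eq (tmul x u) x -> lpa_eq (tmul u x) x ->
    lpa_eq (tmul x (tstar x)) u -> lpa_eq (tmul (tstar x) x) u.

End LeavittPathAlgebra.

(* Main.v *)
(* Direct finiteness implies finiteness because [u = x x^*] is self-adjoint, so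
   that [y = x^*] is allowed in direct finiteness. If a closed path [c] at [v]
   has an exit [f], then [x = c^*] contradicts finiteness: [c^* c = v], but
   [c c^* = v] would give [f^* = f^* c c^* = 0], hence [r(f) = 0], whereas
   vertices act nontrivially in a representation of [L_K(E)].

   If [x y = u] and [d = u - y x <> 0], then the elements [y^i d x^j] behave as
   matrix units, hence are linearly independent, and the subalgebra generated by
   [x], [y], [u] grows at least quadratically. If [E] is no-exit, however,
   finitely many vertices and edges generate an algebra of linear growth: words
   of length [n] are spanned by the [p q^*] with paths [p], [q] of total length
   at most [n], one of which avoids all cycles; there are finitely many paths of
   the latter kind, and a path that enters a cycle is from then on determined by
   its length. *)

Require Import Defs.
From HB Require Import structures.
From mathcomp Require Import all_boot all_order all_algebra.
From mathcomp Require Import zify boolp classical_sets functions.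
From Stdlib Require List.

Set Implicit Arguments.
Unset Strict Implicit.
Unset Printing Implicit Defensive.
Import GRing.Theory.
Local Open Scope ring_scope.

Section Sequences.
Variable T : eqType.
Implicit Types (x : T) (l : seq T).

Lemma InP x l : reflect (List.In x l) (x \in l).
Proof.
elim: l => [|y l IHl]; first by constructor.
rewrite inE eq_sym; apply: (iffP orP) => /= -[/eqP|/IHl]; by [left|right].
Qed.

Lemma NoDupP l : reflect (List.NoDup l) (uniq l).
Proof.
elim: l => [|x l IHl] /=; first by left; apply: List.NoDup_nil.
apply: (iffP andP) => [[/InP xl /IHl]|/List.NoDup_cons_iff[/InP xl /IHl]//].
exact: List.NoDup_cons.
Qed.

Lemma List_lastE x l : List.last l x = last x l.
Proof. by elim: l x => //= y [|z l] IHl x //; apply: IHl. Qed.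

Lemma not_uniq_map_cat (T' : eqType) (f : T -> T') l : ~~ uniq (map f l) ->
  exists l1 x l2 y l3, l = l1 ++ (x :: l2) ++ y :: l3 /\ f x = f y.
Proof.
elim: l => //= x l IHl; rewrite negb_and negbK.
case/orP => [/mapP[y /splitPr[l2 l3] xy]|/IHl[l1 [y [l2 [z [l3 [-> yz]]]]]]].
  by exists [::], x, l2, y, l3.
by exists (x :: l1), y, l2, z, l3.
Qed.

Lemma sum_if_eq (M : nmodType) l x (m : M) :
  uniq l -> \sum_(y <- l) (if x == y then m else 0) = if x \in l then m else 0.
Proof.
move=> l_uniq; case: ifPn => [xl|/negP xl].
  rewrite (bigD1_seq x) //= eqxx big1 ?addr0 // => y /negbTE yx.
  by rewrite eq_sym yx.
by rewrite big1_seq // => y /andP[_ yl]; case: eqP => // xy; rewrite xy in xl.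
Qed.

End Sequences.

(** * Direct finiteness and growth *)

Section DirectFiniteness.
Variables (A : Type) (mul : A -> A -> A) (star : A -> A).

Definition corner u x : Prop := mul u x = x /\ mul x u = x.

Definition directly_finite : Prop := forall x y u,
  mul u u = u -> corner u x -> corner u y -> mul x y = u -> mul y x = u.

Definition star_finite : Prop := forall x u,
  mul u u = u -> corner u x -> mul x (star x) = u -> mul (star x) x = u.

Lemma directly_finite_star_finite :
    involutive star -> {morph star : x y / mul x y >-> mul y x} ->
  directly_finite -> star_finite.
Proof.
move=> starK starM dfin x u uu [ux xu] xxu.
have star_u : star u = u by rewrite -xxu starM starK.
by apply: dfin; rewrite // /corner -{1 2}star_u -!starM xu ux.
Qed.

End DirectFiniteness.

Section LinearSpan.
Variable K : nzRingType.

Inductive lspan (A : lmodType K) (S : A -> Prop) : A -> Prop :=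
  | lspan_gen z of S z : lspan S z
  | lspan0 : lspan S 0
  | lspanD x y of lspan S x & lspan S y : lspan S (x + y)
  | lspanZ a x of lspan S x : lspan S (a *: x).

Lemma lspanB (A : lmodType K) (S : A -> Prop) x y :
  lspan S x -> lspan S y -> lspan S (x - y).
Proof. by move=> Sx Sy; rewrite -scaleN1r; apply/lspanD/lspanZ. Qed.

Lemma lspan_linear (A B : lmodType K) (f : {linear A -> B})
    (S : A -> Prop) (T : B -> Prop) :
  (forall z, S z -> lspan T (f z)) -> forall z, lspan S z -> lspan T (f z).
Proof.
move=> fS z; elim=> {z} [z /fS//||x y _ Tx _ Ty|a x _ Tx].
- by rewrite linear0; apply: lspan0.
- by rewrite linearD; apply: lspanD.
- by rewrite linearZ; apply: lspanZ.
Qed.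

Lemma lspan_linearr (A B C : lmodType K) (f : {bilinear A -> B -> C}) x
    (S : B -> Prop) (T : C -> Prop) :
    (forall y, S y -> lspan T (f x y)) ->
  forall y, lspan S y -> lspan T (f x y).
Proof. exact: lspan_linear. Qed.

Lemma lspan_bilinear (A B C : lmodType K) (f : {bilinear A -> B -> C})
    (S : A -> Prop) (T : B -> Prop) (U : C -> Prop) :
    (forall x y, S x -> T y -> lspan U (f x y)) ->
  forall x y, lspan S x -> lspan T y -> lspan U (f x y).
Proof.
move=> fST x y Sx; move: y; apply: lspan_linearr => y Ty.
by apply: (lspan_linear (f := applyr f y)) Sx => z Sz; apply: fST.
Qed.

Lemma lspan_trans (A : lmodType K) (S T : A -> Prop) :
  (forall z, S z -> lspan T z) -> forall z, lspan S z -> lspan T z.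
Proof. exact: (lspan_linear (f := idfun)). Qed.

Lemma sub_lspan (A : lmodType K) (S T : A -> Prop) :
  (forall z, S z -> T z) -> forall z, lspan S z -> lspan T z.
Proof. by move=> ST; apply: lspan_trans => z /ST; apply: lspan_gen. Qed.

Lemma lspan_seqP (A : lmodType K) (B : seq A) z :
  lspan (fun x => x \in B) z ->
  exists c : 'I_(size B) -> K, z = \sum_i c i *: B`_i.
Proof.
elim=> {z} [z zB||x y _ [c ->] _ [c' ->]|a x _ [c ->]].
- have lt_z : (index z B < size B)%N by rewrite index_mem.
  exists (fun i => (i == Ordinal lt_z)%:R).
  rewrite (bigD1 (Ordinal lt_z)) //= eqxx scale1r nth_index // big1 ?addr0 //.
  by move=> i /negbTE ->; rewrite scale0r.
- by exists (fun=> 0); rewrite big1 // => i _; rewrite scale0r.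
- exists (fun i => c i + c' i); rewrite -big_split /=.
  by apply: eq_bigr => i _; rewrite scalerDl.
- exists (fun i => a * c i); rewrite scaler_sumr.
  by apply: eq_bigr => i _; rewrite scalerA.
Qed.

End LinearSpan.

Lemma lspan_lin_dep (K : fieldType) (A : lmodType K) (I : finType) (B : seq A)
    (X : I -> A) :
    (size B < #|I|)%N -> (forall i, lspan (fun x => x \in B) (X i)) ->
  exists c : I -> K, (exists i, c i != 0) /\ \sum_i c i *: X i = 0.
Proof.
move=> ltBI /(_ _)/lspan_seqP/cid coordX.
pose M := \matrix_(k < #|I|, j < size B) projT1 (coordX (enum_val k)) j.
have /rowV0Pn[k /sub_kermxP kM k_neq0] : kermx M != 0.
  by rewrite kermx_eq0 /row_free neq_ltn (leq_ltn_trans (rank_leq_col M)).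
exists (fun i => k 0 (enum_rank i)); split.
  have /rV0Pn[i ki] := k_neq0; by exists (enum_val i); rewrite enum_valK.
transitivity (\sum_j (k *m M) 0 j *: B`_j); last first.
  by rewrite kM big1 // => j _; rewrite mxE scale0r.
transitivity (\sum_i \sum_j (k 0 (enum_rank i) * M (enum_rank i) j) *: B`_j).
  apply: eq_bigr => i _; rewrite {1}(projT2 (coordX i)) scaler_sumr.
  by apply: eq_bigr => j _; rewrite scalerA mxE enum_rankK.
rewrite exchange_big; apply: eq_bigr => j _; rewrite -scaler_suml mxE.
by rewrite [in RHS](reindex enum_rank) //; apply/onW_bij/enum_rank_bij.
Qed.

Section Growth.
Variables (K : nzRingType) (A : lmodType K) (S : nat -> A -> Prop).

Definition subquadratic_growth : Prop := forall c, exists m (B : seq A),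
  (size B < m * m)%N /\
  forall z, S (c * m) z -> lspan (fun x => x \in B) z.

Definition linear_growth : Prop := exists C, forall n, exists B : seq A,
  (size B <= C * n.+1)%N /\ forall z, S n z -> lspan (fun x => x \in B) z.

Lemma linear_growth_subquadratic : linear_growth -> subquadratic_growth.
Proof.
move=> [C SC] c; pose m := (C * c.+1).+1.
have [B [szB SB]] := SC (c * m)%N; exists m, B; split=> //.
by apply: leq_ltn_trans szB _; rewrite /m; nia.
Qed.

End Growth.

Section MatrixUnits.
Variables (K : fieldType) (A : lmodType K) (mul : {bilinear A -> A -> A}).
Hypothesis mulA : associative mul.
Local Infix "**" := mul (at level 40, left associativity).

Variables x y u : A.
Hypotheses (uu : u ** u = u) (u_x : corner mul u x) (u_y : corner mul u y).
Hypothesis xy : x ** y = u.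

Definition defect : A := u - y ** x.
Local Notation d := defect.

Lemma mul_defect : x ** d = 0.
Proof. by rewrite linearBr mulA xy u_x.1 u_x.2 subrr. Qed.

Lemma defect_mul : d ** y = 0.
Proof. by rewrite linearBl -mulA xy u_y.1 u_y.2 subrr. Qed.

Lemma corner_defect : u ** d = d.
Proof. by rewrite linearBr mulA u_y.1 uu. Qed.

Lemma defect_idem : d ** d = d.
Proof.
by rewrite {1}/d linearBl corner_defect -mulA mul_defect linear0r subr0.
Qed.

Definition matrix_unit i j : A := iter i (mul y) (d ** iter j (mul x) u).

Lemma mul_iter n z t : iter n (mul x) z ** t = iter n (mul x) (z ** t).
Proof. by elim: n => //= n IHn; rewrite -mulA IHn. Qed.

Lemma iter_mul0 n : iter n (mul x) 0 = 0.
Proof. by elim: n => //= n ->; rewrite linear0r. Qed.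

Lemma corner_iter_defect n t :
  u ** iter n (mul y) (d ** t) = iter n (mul y) (d ** t).
Proof. by case: n => [|n] /=; rewrite mulA ?corner_defect ?u_y.1. Qed.

(* [x^k] kills [y^i d] for [i < k] and turns it into [y^(i-k) d], which [d]
   kills, for [i > k]. *)
Lemma defect_iter_iter k i t :
  d ** iter k (mul x) (iter i (mul y) (d ** t)) = if i == k then d ** t else 0.
Proof.
elim: k i => [|k IHk] [|i]; first by rewrite /= mulA defect_idem.
- by rewrite /= mulA defect_mul linear0l.
- by rewrite iterSr /= mulA mul_defect linear0l iter_mul0 linear0r.
- by rewrite iterSr /= mulA xy corner_iter_defect eqSS.
Qed.

Lemma matrix_unit_coeff k l i j :
  d ** iter k (mul x) u ** matrix_unit i j ** iter l (mul y) d =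
  if (i == k) && (j == l) then d else 0.
Proof.
rewrite -(mulA d) mul_iter corner_iter_defect defect_iter_iter.
case: (i == k) => /=; last by rewrite linear0l.
rewrite -mulA mul_iter -{2}defect_idem corner_iter_defect defect_iter_iter.
by rewrite eq_sym defect_idem.
Qed.

Lemma matrix_unit_lin_indep m (c : 'I_m * 'I_m -> K) : d != 0 ->
  \sum_ij c ij *: matrix_unit ij.1 ij.2 = 0 -> forall kl, c kl = 0.
Proof.
move=> d_neq0 + kl.
pose coeff z := d ** iter kl.1 (mul x) u ** z ** iter kl.2 (mul y) d.
move=> /(congr1 coeff); rewrite {}/coeff.
rewrite linear0r linear0l linear_sumr linear_sumlz (bigD1 kl) //= big1.
  rewrite linearZr_LR linearZl_LR matrix_unit_coeff !eqxx /= addr0 => /eqP.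
  by rewrite scaler_eq0 (negbTE d_neq0) orbF => /eqP.
move=> ij ijkl; rewrite linearZr_LR linearZl_LR matrix_unit_coeff.
have /negbTE -> : ~~ ((ij.1 == kl.1 :> nat) && (ij.2 == kl.2 :> nat)).
  by case: ij kl ijkl => [i j] [k l]; rewrite xpair_eqE.
by rewrite scaler0.
Qed.

Section Filtration.
Variable S : nat -> A -> Prop.
Hypothesis S_leq : forall m n z, (m <= n)%N -> S m z -> S n z.
Hypothesis S_mul :
  forall m n z t, S m z -> S n t -> lspan (S (m + n)) (z ** t).

Lemma lspan_leq m n z : (m <= n)%N -> lspan (S m) z -> lspan (S n) z.
Proof. by move=> mn; apply: sub_lspan => t; apply: S_leq. Qed.

Lemma lspan_mul m n z t :
  lspan (S m) z -> lspan (S n) t -> lspan (S (m + n)) (z ** t).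
Proof. by apply: lspan_bilinear => ? ?; apply: S_mul. Qed.

Lemma lspan_iter_mul n m i z t : lspan (S n) z -> lspan (S m) t ->
  lspan (S (i * n + m)) (iter i (mul z) t).
Proof.
by move=> nz mt; elim: i => //= i IHi; rewrite mulSn -addnA; apply: lspan_mul.
Qed.

Lemma lspan_matrix_unit n i j :
  lspan (S n) x -> lspan (S n) y -> lspan (S n) u ->
  lspan (S ((i + j + 3) * n)) (matrix_unit i j).
Proof.
move=> nx ny nu; have nd : lspan (S (n + n)) d.
  by apply: lspanB; [apply: lspan_leq nu; apply: leq_addr|apply: lspan_mul].
have := lspan_iter_mul i ny (lspan_mul nd (lspan_iter_mul j nx nu)).
by congr lspan; congr S; lia.
Qed.

(* If [y x <> u], the [m * m] linearly independent [matrix_unit i j] with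
   [i, j < m] all lie in the span of [S (3 * n * m)]. *)
Lemma subquadratic_growth_mulC n : subquadratic_growth S ->
    lspan (S n) x -> lspan (S n) y -> lspan (S n) u ->
  y ** x = u.
Proof.
move=> growth nx ny nu; have [m [B [ltBm SB]]] := growth (3 * n)%N.
have B_spans (ij : 'I_m * 'I_m) :
    lspan (fun z => z \in B) (matrix_unit ij.1 ij.2).
  apply: (lspan_trans SB); apply: lspan_leq (lspan_matrix_unit _ _ nx ny nu).
  by case: ij => [[i ltim] [j ltjm]] /=; nia.
have [|c [[ij cij] c0]] := lspan_lin_dep _ B_spans.
  by rewrite card_prod card_ord.
apply/esym/eqP; rewrite -subr_eq0; apply: contraT => d_neq0.
by rewrite (matrix_unit_lin_indep d_neq0 c0 ij) eqxx in cij.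
Qed.

End Filtration.
End MatrixUnits.

(** * The Leavitt path algebra *)

Section LeavittPathAlgebra.
Local Open Scope quotient_scope.
Variables (K : fieldType) (V Ed : Type) (s r : Ed -> V).
Local Notation tm := (term K V Ed).

Definition lpa_eqb (x y : {classic tm}) : bool := `[< lpa_eq s r x y >].

Lemma lpa_eqb_refl : reflexive lpa_eqb.
Proof. by move=> x; apply/asboolP; apply: Defs.eq_refl. Qed.

Lemma lpa_eqb_sym : symmetric lpa_eqb.
Proof. by move=> x y; apply/asboolP/asboolP; apply: Defs.eq_sym. Qed.

Lemma lpa_eqb_trans : transitive lpa_eqb.
Proof.
by move=> y x z /asboolP xy /asboolP yz; apply/asboolP; apply: Defs.eq_trans yz.
Qed.

Canonical lpa_equiv := EquivRel lpa_eqb lpa_eqb_refl lpa_eqb_sym lpa_eqb_trans.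

Definition lpa := {eq_quot lpa_equiv}.
HB.instance Definition _ := Choice.on lpa.

Definition lpa_of (x : tm) : lpa := \pi_{eq_quot lpa_equiv} (x : {classic tm}).

Lemma lpa_ofP x y : lpa_of x = lpa_of y <-> lpa_eq s r x y.
Proof.
split=> [/eqmodP /asboolP //|xy].
by apply/eqmodP/asboolP.
Qed.

Definition lpa_repr (x : lpa) : tm := repr x.

Lemma lpa_reprK : cancel lpa_repr lpa_of.
Proof. exact: reprK. Qed.

Lemma lpa_repr_of x : lpa_eq s r (lpa_repr (lpa_of x)) x.
Proof. by apply/lpa_ofP; rewrite lpa_reprK. Qed.

Lemma lpa_ind (P : lpa -> Prop) : (forall x, P (lpa_of x)) -> forall x, P x.
Proof. by move=> Pof x; rewrite -[x]lpa_reprK. Qed.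

Definition lpa_add x y := lpa_of (tadd (lpa_repr x) (lpa_repr y)).
Definition lpa_scale a x := lpa_of (tscale a (lpa_repr x)).
Definition lpa_mul x y := lpa_of (tmul (lpa_repr x) (lpa_repr y)).

Lemma lpa_of_add x y : lpa_of (tadd x y) = lpa_add (lpa_of x) (lpa_of y).
Proof. by apply/lpa_ofP/eq_add; apply/Defs.eq_sym/lpa_repr_of. Qed.

Lemma lpa_of_scale a x : lpa_of (tscale a x) = lpa_scale a (lpa_of x).
Proof. by apply/lpa_ofP/eq_scale; apply/Defs.eq_sym/lpa_repr_of. Qed.

Lemma lpa_ofM x y : lpa_of (tmul x y) = lpa_mul (lpa_of x) (lpa_of y).
Proof. by apply/lpa_ofP/eq_mul; apply/Defs.eq_sym/lpa_repr_of. Qed.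

Lemma lpa_addA : associative lpa_add.
Proof.
elim/lpa_ind=> x; elim/lpa_ind=> y; elim/lpa_ind=> z.
by rewrite -!lpa_of_add; apply/lpa_ofP/ax_addA.
Qed.

Lemma lpa_addC : commutative lpa_add.
Proof.
elim/lpa_ind=> x; elim/lpa_ind=> y.
by rewrite -!lpa_of_add; apply/lpa_ofP/ax_addC.
Qed.

Lemma lpa_add0 : left_id (lpa_of (tzero _ _ _)) lpa_add.
Proof.
by elim/lpa_ind=> x; rewrite lpa_addC -lpa_of_add; apply/lpa_ofP/ax_add0.
Qed.

Lemma lpa_addN : left_inverse (lpa_of (tzero _ _ _)) (lpa_scale (-1)) lpa_add.
Proof.
elim/lpa_ind=> x; rewrite lpa_addC -lpa_of_scale -lpa_of_add.
exact/lpa_ofP/ax_addN.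
Qed.

HB.instance Definition _ :=
  GRing.isZmodule.Build lpa lpa_addA lpa_addC lpa_add0 lpa_addN.

Lemma lpa_of0 : lpa_of (tzero _ _ _) = 0. Proof. by []. Qed.

Lemma lpa_ofD x y : lpa_of (tadd x y) = lpa_of x + lpa_of y.
Proof. exact: lpa_of_add. Qed.

Lemma lpa_scaleA a b x : lpa_scale a (lpa_scale b x) = lpa_scale (a * b) x.
Proof.
by elim/lpa_ind: x => x; rewrite -!lpa_of_scale; apply/lpa_ofP/ax_scaleA.
Qed.

Lemma lpa_scale1 : left_id 1 lpa_scale.
Proof.
by elim/lpa_ind=> x; rewrite -lpa_of_scale; apply/lpa_ofP/ax_scale1.
Qed.

Lemma lpa_scaleDr : right_distributive lpa_scale +%R.
Proof.
move=> a; elim/lpa_ind=> x; elim/lpa_ind=> y.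
by rewrite -lpa_ofD -!lpa_of_scale -lpa_ofD; apply/lpa_ofP/ax_scaleDr.
Qed.

Lemma lpa_scaleDl x : {morph lpa_scale^~ x : a b / a + b}.
Proof.
move=> a b; elim/lpa_ind: x => x; rewrite /= -!lpa_of_scale -lpa_ofD.
exact/lpa_ofP/ax_scaleDl.
Qed.

HB.instance Definition _ := GRing.Zmodule_isLmodule.Build K lpa
  lpa_scaleA lpa_scale1 lpa_scaleDr lpa_scaleDl.

Lemma lpa_ofZ a x : lpa_of (tscale a x) = a *: lpa_of x.
Proof. exact: lpa_of_scale. Qed.

Lemma lpa_mulA : associative lpa_mul.
Proof.
elim/lpa_ind=> x; elim/lpa_ind=> y; elim/lpa_ind=> z.
by rewrite -!lpa_ofM; apply/lpa_ofP/ax_mulA.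
Qed.

Lemma lpa_mul_bilinear : bilinear_for *:%R *:%R lpa_mul.
Proof.
split=> z a; elim/lpa_ind: z => z; elim/lpa_ind=> x; elim/lpa_ind=> y /=;
  rewrite -(lpa_ofZ a x) -(lpa_ofD _ y) -!lpa_ofM -lpa_ofZ -lpa_ofD;
  apply/lpa_ofP.
- apply: Defs.eq_trans (ax_mulDl _ _ _ _ _) _.
  by apply: eq_add (Defs.eq_refl _ _ _); apply: ax_scale_mull.
- apply: Defs.eq_trans (ax_mulDr _ _ _ _ _) _.
  by apply: eq_add (Defs.eq_refl _ _ _); apply: ax_scale_mulr.
Qed.

HB.instance Definition _ :=
  bilinear_isBilinear.Build K lpa lpa lpa *:%R *:%R lpa_mul lpa_mul_bilinear.

Definition vertex v : lpa := lpa_of (tgen K (GV Ed v)).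
Definition edge e : lpa := lpa_of (tgen K (GE V e)).
Definition ghost e : lpa := lpa_of (tgen K (GG V e)).

Local Infix "**" := lpa_mul (at level 40, left associativity).

Lemma vertex_idem v : vertex v ** vertex v = vertex v.
Proof. by rewrite -lpa_ofM; apply/lpa_ofP/rel_V_eq. Qed.

Lemma vertex_orth v w : v <> w -> vertex v ** vertex w = 0.
Proof. by move=> vw; rewrite -lpa_ofM; apply/lpa_ofP/rel_V_neq. Qed.

Lemma source_edge e : vertex (s e) ** edge e = edge e.
Proof. by rewrite -lpa_ofM; apply/lpa_ofP/rel_E1s. Qed.

Lemma edge_range e : edge e ** vertex (r e) = edge e.
Proof. by rewrite -lpa_ofM; apply/lpa_ofP/rel_E1r. Qed.

Lemma range_ghost e : vertex (r e) ** ghost e = ghost e.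
Proof. by rewrite -lpa_ofM; apply/lpa_ofP/rel_E2r. Qed.

Lemma ghost_source e : ghost e ** vertex (s e) = ghost e.
Proof. by rewrite -lpa_ofM; apply/lpa_ofP/rel_E2s. Qed.

Lemma ghost_edge e : ghost e ** edge e = vertex (r e).
Proof. by rewrite -lpa_ofM; apply/lpa_ofP/rel_CK1_eq. Qed.

Lemma ghost_edge_orth e f : e <> f -> ghost e ** edge f = 0.
Proof. by move=> ef; rewrite -lpa_ofM; apply/lpa_ofP/rel_CK1_neq. Qed.

Lemma edge_ghost e : (forall f, s f = s e -> f = e) ->
  edge e ** ghost e = vertex (s e).
Proof.
move=> e_only; rewrite -lpa_ofM -[LHS]addr0 -lpa_of0 -lpa_ofD.
apply/esym/lpa_ofP; apply: (@rel_CK2 _ _ _ s r _ [:: e]) => //.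
  by apply: List.NoDup_cons => //; apply: List.NoDup_nil.
by move=> f; split=> [[<-|]//|/e_only->]; left.
Qed.

Lemma lpa_directly_finiteE :
  lpa_directly_finite K s r <-> directly_finite lpa_mul.
Proof.
split=> [dfin x y u uu [ux xu] [uy yu] xy|dfin x y u].
  rewrite -[x]lpa_reprK -[y]lpa_reprK -[u]lpa_reprK -!lpa_ofM
    in uu ux xu uy yu xy *.
  by apply/lpa_ofP; apply: dfin; apply/lpa_ofP.
rewrite -!lpa_ofP !lpa_ofM => uu xu ux yu uy.
exact: dfin.
Qed.

Section Star.
Variable sigma : {rmorphism K -> K}.
Hypothesis sigmaK : involutive sigma.

Lemma tstarK : involutive (tstar sigma (V := V) (Ed := Ed)).
Proof.
elim=> [[]||x IHx y IHy|a x IHx|x IHx y IHy] //=.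
- by rewrite IHx IHy.
- by rewrite sigmaK IHx.
- by rewrite IHx IHy.
Qed.

Lemma tstar_tsum_ghost (l : seq Ed) :
  tstar sigma (tsum_ghost K V l) = tsum_ghost K V l.
Proof. by elim: l => //= e l ->. Qed.

Lemma tstar_eq x y : lpa_eq s r x y ->
  lpa_eq s r (tstar sigma x) (tstar sigma y).
Proof.
elim=> {x y} /=; try by constructor.
- by move=> x y z _ xy _; apply: Defs.eq_trans.
- by move=> x; rewrite rmorphN1; apply: ax_addN.
- by move=> x; rewrite rmorph1; apply: ax_scale1.
- by move=> a b x; rewrite rmorphM; apply: ax_scaleA.
- by move=> a b x; rewrite rmorphD; apply: ax_scaleDl.
- by move=> x y z; apply/Defs.eq_sym/ax_mulA.
- by move=> v w vw; apply: rel_V_neq => /esym.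
- by move=> e f ef; apply: rel_CK1_neq => /esym.
- by move=> v l l0 ul lE; rewrite tstar_tsum_ghost; apply: rel_CK2.
Qed.

Definition lpa_star (x : lpa) : lpa := lpa_of (tstar sigma (lpa_repr x)).

Lemma lpa_of_star x : lpa_of (tstar sigma x) = lpa_star (lpa_of x).
Proof. by apply/lpa_ofP/tstar_eq/Defs.eq_sym/lpa_repr_of. Qed.

Lemma lpa_starK : involutive lpa_star.
Proof. by elim/lpa_ind=> x; rewrite -!lpa_of_star tstarK. Qed.

Lemma lpa_starM :
  {morph lpa_star : x y / lpa_mul x y >-> lpa_mul y x}.
Proof.
elim/lpa_ind=> x; elim/lpa_ind=> y.
by rewrite -lpa_ofM -!lpa_of_star -lpa_ofM.
Qed.

Lemma lpa_star_vertex v : lpa_star (vertex v) = vertex v.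
Proof. by rewrite -lpa_of_star. Qed.

Lemma lpa_star_ghost e : lpa_star (ghost e) = edge e.
Proof. by rewrite -lpa_of_star. Qed.

Lemma lpa_finiteE : lpa_finite sigma s r <-> star_finite lpa_mul lpa_star.
Proof.
split=> [fin x u uu [ux xu] xxu|fin x u].
  rewrite -[x]lpa_reprK -[u]lpa_reprK -lpa_of_star -!lpa_ofM in uu ux xu xxu *.
  by apply/lpa_ofP; apply: fin; apply/lpa_ofP.
rewrite -!lpa_ofP !lpa_ofM lpa_of_star => uu xu ux.
exact: fin.
Qed.

End Star.
End LeavittPathAlgebra.

(** * Vertices are nonzero *)

Section Representation.
Variables (K : fieldType) (V Ed : Type) (s r : Ed -> V) (M : lmodType K).
Variable rho : gen V Ed -> {linear M -> M}.
Local Notation rhoV v := (rho (GV Ed v)).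
Local Notation rhoE e := (rho (GE V e)).
Local Notation rhoG e := (rho (GG V e)).

Definition regular_enum (v : V) (l : seq Ed) : Prop :=
  [/\ l <> [::], List.NoDup l & forall e, List.In e l <-> s e = v].

Record leavitt_family : Prop := LeavittFamily {
  family_V_eq v phi : rhoV v (rhoV v phi) = rhoV v phi;
  family_V_neq v w phi : v <> w -> rhoV v (rhoV w phi) = 0;
  family_E1s e phi : rhoV (s e) (rhoE e phi) = rhoE e phi;
  family_E1r e phi : rhoE e (rhoV (r e) phi) = rhoE e phi;
  family_E2r e phi : rhoV (r e) (rhoG e phi) = rhoG e phi;
  family_E2s e phi : rhoG e (rhoV (s e) phi) = rhoG e phi;
  family_CK1_eq e phi : rhoG e (rhoE e phi) = rhoV (r e) phi;
  family_CK1_neq e f phi : e <> f -> rhoG e (rhoE f phi) = 0;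
  family_CK2 v l phi : regular_enum v l ->
    rhoV v phi = \sum_(e <- l) rhoE e (rhoG e phi)
}.

Fixpoint act (x : term K V Ed) (phi : M) : M :=
  match x with
  | tgen g => rho g phi
  | tzero => 0
  | tadd x y => act x phi + act y phi
  | tscale a x => a *: act x phi
  | tmul x y => act x (act y phi)
  end.

Lemma act_linear x : linear (act x).
Proof.
elim: x => [g||x IHx y IHy|b x IHx|x IHx y IHy] a phi psi /=.
- by rewrite linearP.
- by rewrite scaler0 addr0.
- by rewrite IHx IHy scalerDr addrACA.
- by rewrite IHx scalerDr !scalerA mulrC.
- by rewrite IHy IHx.
Qed.

HB.instance Definition _ x :=
  GRing.isLinear.Build K M M *:%R (act x) (act_linear x).

Lemma act_tsum_ghost l phi :
  act (tsum_ghost K V l) phi = \sum_(e <- l) rhoE e (rhoG e phi).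
Proof. by elim: l => [|e l IHl] /=; rewrite (big_nil, big_cons) ?IHl. Qed.

Lemma act_lpa_eq : leavitt_family ->
  forall x y, lpa_eq s r x y -> forall phi, act x phi = act y phi.
Proof.
move=> fam x y; elim=> {x y} /=.
- by [].
- by move=> x y _ xy phi; rewrite xy.
- by move=> x y z _ xy _ yz phi; rewrite xy.
- by move=> x x' y y' _ xx _ yy phi; rewrite xx yy.
- by move=> a x x' _ xx phi; rewrite xx.
- by move=> x x' y y' _ xx _ yy phi; rewrite yy xx.
- by move=> x y z phi; rewrite addrA.
- by move=> x y phi; rewrite addrC.
- by move=> x phi; rewrite addr0.
- by move=> x phi; rewrite scaleN1r subrr.
- by move=> x phi; rewrite scale1r.
- by move=> a b x phi; rewrite scalerA.
- by move=> a x y phi; rewrite scalerDr.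
- by move=> a b x phi; rewrite scalerDl.
- by [].
- by [].
- by move=> x y z phi; rewrite linearD.
- by [].
- by move=> a x y phi; rewrite linearZ.
- exact: family_V_eq.
- by move=> v w vw phi; apply: family_V_neq.
- exact: family_E1s.
- exact: family_E1r.
- exact: family_E2r.
- exact: family_E2s.
- exact: family_CK1_eq.
- by move=> e f ef phi; apply: family_CK1_neq.
- by move=> v l l0 ul lE phi; rewrite act_tsum_ghost; apply: family_CK2.
Qed.

End Representation.

(* [branch e] embeds the fibre over [r e] into the fibre over [s e]. The images
   for the edges leaving a vertex are disjoint, and they cover its fibre if it
   is regular, as (CK2) demands. *)
Record branching_system (V Ed I : Type) (s r : Ed -> V) (fibre : I -> V)
    (branch : Ed -> I -> I) (unbranch : I -> option (Ed * I)) : Prop :=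
  BranchingSystem {
    fibre_branch e i : fibre (branch e i) = s e;
    branchK e i : fibre i = r e -> unbranch (branch e i) = Some (e, i);
    unbranchK i e j :
      unbranch i = Some (e, j) -> branch e j = i /\ fibre j = r e;
    unbranch_regular i l : regular_enum s (fibre i) l -> unbranch i <> None
  }.

Section BranchingRepresentation.
Variables (K : fieldType) (V Ed : eqType) (s r : Ed -> V).
Variables (I : Type) (fibre : I -> V).
Variables (branch : Ed -> I -> I) (unbranch : I -> option (Ed * I)).
Hypothesis sys : branching_system s r fibre branch unbranch.

Definition pullback (g : I -> option I) (phi : I -> K^o) : I -> K^o :=
  fun i => oapp phi 0 (g i).

Lemma pullback_linear g : linear (pullback g).
Proof.
move=> a phi psi; apply/funext => i; rewrite /pullback !fctE.
by case: (g i) => //=; rewrite scaler0 addr0.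
Qed.

HB.instance Definition _ g :=
  GRing.isLinear.Build K (I -> K^o) (I -> K^o) *:%R (pullback g)
    (pullback_linear g).

Definition branch_gen (x : gen V Ed) (i : I) : option I :=
  match x with
  | GV v => if fibre i == v then Some i else None
  | GE e => if unbranch i is Some (f, j) then
              if f == e then Some j else None
            else None
  | GG e => if fibre i == r e then Some (branch e i) else None
  end.

Lemma unbranch_source i e j : unbranch i = Some (e, j) -> s e = fibre i.
Proof. by move=> /(unbranchK sys)[<- _]; rewrite (fibre_branch sys). Qed.

Lemma pullback_edge_ghost e phi i :
  pullback (branch_gen (GE V e)) (pullback (branch_gen (GG V e)) phi) i =
  if unbranch i is Some (f, _) then if f == e then phi i else 0 else 0.
Proof.
rewrite /pullback /=; case ui: (unbranch i) => [[f j]|] //=.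
by case: eqP ui => //= -> /(unbranchK sys)[<- ->] /=; rewrite eqxx.
Qed.

Lemma pullback_vertex v l phi : regular_enum s v l ->
  pullback (branch_gen (GV Ed v)) phi =
  \sum_(e <- l)
    pullback (branch_gen (GE V e)) (pullback (branch_gen (GG V e)) phi).
Proof.
move=> vl; have [_ /NoDupP l_uniq lE] := vl; apply/funext => i.
rewrite fct_sumE; under eq_bigr do rewrite pullback_edge_ghost.
rewrite {1}/pullback /=; case ui: (unbranch i) => [[f j]|]; last first.
  rewrite big1_eq; case: eqP => //= iv.
  by case: (unbranch_regular sys (i := i) (l := l)); rewrite ?iv.
have <- : (f \in l) = (fibre i == v).
  by rewrite -(unbranch_source ui); apply/idP/eqP => [/InP/lE|/lE/InP].
by rewrite sum_if_eq //; case: ifP.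
Qed.

Lemma branching_leavitt_family :
  leavitt_family s r (fun x => pullback (branch_gen x)).
Proof.
split=> /=.
- move=> v phi; apply/funext => i; rewrite /pullback /=.
  by case: ifP => //= ->.
- move=> v w phi vw; apply/funext => i; rewrite /pullback /=.
  by case: eqP => //= ->; case: eqP.
- move=> e phi; apply/funext => i; rewrite /pullback /=.
  case: eqP => //= ie; case ui: (unbranch i) => [[f j]|] //.
  by case: eqP => //= fe; case: ie; rewrite -(unbranch_source ui) fe.
- move=> e phi; apply/funext => i; rewrite /pullback /=.
  case ui: (unbranch i) => [[f j]|] //; case: eqP ui => //= ->.
  by move=> /(unbranchK sys)[_ ->]; rewrite eqxx.
- move=> e phi; apply/funext => i; rewrite /pullback /=.
  by case: ifP => //= ->.
- move=> e phi; apply/funext => i; rewrite /pullback /=.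
  by case: ifP => //= _; rewrite (fibre_branch sys) eqxx.
- move=> e phi; apply/funext => i; rewrite /pullback /=.
  by case: eqP => //= /(branchK sys) ->; rewrite eqxx.
- move=> e f phi ef; apply/funext => i; rewrite /pullback /=.
  by case: eqP => //= /(branchK sys) ->; case: eqP.
- exact: pullback_vertex.
Qed.

Lemma branching_vertex_neq0 i : vertex K s r (fibre i) != 0.
Proof.
apply/eqP => /lpa_ofP /(act_lpa_eq branching_leavitt_family) /(_ (fun=> 1)).
move=> /(congr1 (@^~ i)); rewrite /= /pullback /= eqxx.
by move=> /eqP; rewrite oner_eq0.
Qed.

End BranchingRepresentation.

(* The fibre over [v] is a copy of [seq Ed * nat]. Edges leaving a regular [v]
   are told apart by the residue of the second component, edges leaving any
   other [v] by the head of the first. *)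
Section FreeBranchingSystem.
Variables (K : fieldType) (V Ed : choiceType) (s r : Ed -> V).

Definition regular_edges (v : V) : seq Ed := xget [::] (regular_enum s v).

Lemma regular_edgesP v : regular_edges v <> [::] ->
  regular_enum s v (regular_edges v).
Proof. by rewrite /regular_edges; case: xgetP. Qed.

Lemma regular_edges_neq0 v l :
  regular_enum s v l -> regular_edges v <> [::].
Proof. by move=> /(xgetI [::])[]. Qed.

Local Notation index_set := (V * seq Ed * nat)%type.

Definition free_branch (e : Ed) (i : index_set) : index_set :=
  let: (_, p, n) := i in
  if regular_edges (s e) is e0 :: l then
    (s e, p, n * (size l).+1 + index e (e0 :: l))%N
  else (s e, e :: p, n).

Definition free_unbranch (i : index_set) : option (Ed * index_set) :=
  let: (v, p, n) := i in
  match regular_edges v, p with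
  | e0 :: l, _ => let e := nth e0 (e0 :: l) (n %% (size l).+1) in
                  Some (e, (r e, p, n %/ (size l).+1))
  | [::], e :: q => if s e == v then Some (e, (r e, q, n)) else None
  | [::], [::] => None
  end%N.

Lemma free_branchK e i : i.1.1 = r e ->
  free_unbranch (free_branch e i) = Some (e, i).
Proof.
case: i => [[v p] n] /= ->; rewrite /free_branch /free_unbranch.
case es: (regular_edges (s e)) (@regular_edgesP (s e)) => [|e0 l].
  by rewrite es eqxx.
case=> // _ _ lE; have el : e \in e0 :: l by apply/InP/lE.
have lt_el : (index e (e0 :: l) < (size l).+1)%N by rewrite -index_mem in el.
rewrite es modnMDl modn_small // (nth_index e0 el).
by rewrite divnMDl // divn_small // addn0.
Qed.

Lemma free_unbranchK i e j : free_unbranch i = Some (e, j) ->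
  free_branch e j = i /\ j.1.1 = r e.
Proof.
case: i => [[v p] n]; rewrite /free_unbranch /free_branch.
case ev: (regular_edges v) (@regular_edgesP v) => [|e0 l].
  by case: p => // f q _; case: eqP => // fv [<- <-]; rewrite fv ev.
case=> // _ /NoDupP l_uniq lE [<- <-].
set k := (n %% _)%N; have lt_k : (k < (size l).+1)%N by rewrite ltn_mod.
have -> : s (nth e0 (e0 :: l) k) = v by apply/lE/InP; rewrite mem_nth.
by rewrite ev index_uniq // -divn_eq.
Qed.

Lemma free_unbranch_regular i l :
  regular_enum s i.1.1 l -> free_unbranch i <> None.
Proof.
case: i => [[v p] n] /= /regular_edges_neq0.
by rewrite /free_unbranch; case: (regular_edges v).
Qed.

Lemma free_branching_system :
  branching_system s r (fun i => i.1.1) free_branch free_unbranch.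
Proof.
split.
- by move=> e [[w p] n]; rewrite /free_branch; case: regular_edges.
- exact: free_branchK.
- exact: free_unbranchK.
- exact: free_unbranch_regular.
Qed.

Lemma vertex_neq0 v : vertex K s r v != 0.
Proof. exact: branching_vertex_neq0 free_branching_system (v, [::], 0%N). Qed.

End FreeBranchingSystem.

(** * Walks and cycles *)

Section Walks.
Variables (V Ed : eqType) (s r : Ed -> V).
Implicit Types (v w : V) (e f : Ed) (p q : seq Ed).

Fixpoint walk v p w : bool :=
  if p is e :: p' then (s e == v) && walk (r e) p' w else v == w.

Lemma walk_catP v p q w :
  reflect (exists2 u, walk v p u & walk u q w) (walk v (p ++ q) w).
Proof.
elim: p v => [|e p IHp] v /=.
  by apply: (iffP idP) => [vqw|[u /eqP->//]]; exists v.
apply: (iffP andP) => [[-> /IHp]//|[u /andP[-> pu] qw]].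
by split=> //; apply/IHp; exists u.
Qed.

Lemma walk_rcons v p e w : walk v (rcons p e) w = walk v p (s e) && (r e == w).
Proof.
elim: p v => [|f p IHp] v /=; last by rewrite IHp andbA.
by rewrite eq_sym.
Qed.

Lemma walk_flatten_nseq v p n : walk v p v -> walk v (flatten (nseq n p)) v.
Proof.
move=> vpv; elim: n => [|n IHn] /=; first exact: eqxx.
by apply/walk_catP; exists v.
Qed.

Lemma path_from_walk e p w :
  path_from s r e p /\ r (last e p) = w <-> walk (r e) p w.
Proof.
elim: p e => [|f p IHp] e /=; first by split=> [[_ /eqP]|/eqP].
rewrite eq_sym; split=> [[[-> pf] pw]|/andP[/eqP-> /IHp[]]//].
by rewrite eqxx; apply/IHp.
Qed.

Lemma on_cycle_closed_walk v :
  on_cycle s r v -> exists e p, walk v (e :: p) v.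
Proof.
case=> _ [[e [p [-> [pe [ep _]]]]] [f [/InP ef fv]]].
have : walk (s e) (e :: p) (s e).
  by rewrite /= eqxx; apply/path_from_walk; rewrite -List_lastE.
case/splitPr: ef => p1 p2 /walk_catP[u p1u p2e].
have uv : u = v by case/andP: p2e => /eqP <- _.
rewrite uv in p1u p2e.
by exists f, (p2 ++ p1); rewrite -cat_cons; apply/walk_catP; exists (s e).
Qed.

(* A closed walk that visits a source twice can be shortened by excising the
   closed walk in between. *)
Lemma closed_walk_on_cycle v e p : walk v (e :: p) v -> on_cycle s r v.
Proof.
have [n] := ubnP (size p); elim: n e p => // n IHn e p lpn vpv.
have [up|/not_uniq_map_cat] := boolP (uniq (map s (e :: p))).
  case/andP: vpv => /eqP ev /path_from_walk[pe pv].
  exists (e :: p); split; last by exists e; split=> //; left.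
  exists e, p; split=> //; split=> //; split; last exact/NoDupP.
  by rewrite List_lastE pv.
case=> p1 [f [p2 [g [p3 [Ep fg]]]]]; rewrite Ep in vpv.
have {}vpv : walk v (p1 ++ g :: p3) v.
  have /walk_catP[u p1u /walk_catP[w uw wv]] := vpv.
  apply/walk_catP; exists u => //.
  have /andP[/eqP <- _] := uw; rewrite fg.
  by have /andP[/eqP gw _] := wv; rewrite gw.
have szp : (size (p1 ++ g :: p3) < size (e :: p))%N.
  by rewrite Ep !size_cat ltn_add2l -[ltnLHS]add0n ltn_add2r.
case Eq: (p1 ++ g :: p3) => [|h q]; first by case: (p1) Eq.
by rewrite Eq in vpv szp; apply: IHn vpv; exact: leq_trans szp lpn.
Qed.

Definition cyclic v : bool := `[< on_cycle s r v >].

Lemma cyclicP v : reflect (exists e p, walk v (e :: p) v) (cyclic v).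
Proof.
apply: (iffP (asboolP _)) => [/on_cycle_closed_walk//|[e [p]]].
exact: closed_walk_on_cycle.
Qed.

Definition acyclic p : bool := all (fun e => ~~ cyclic (s e)) p.

Lemma acyclic_uniq v p w : walk v p w -> acyclic p -> uniq p.
Proof.
move=> vpw ap; apply: (@map_uniq _ _ s); apply/idPn => /not_uniq_map_cat.
case=> p1 [e [p2 [f [p3 [Ep ef]]]]]; move: vpw ap; rewrite {}Ep.
case/walk_catP=> u _ /walk_catP[x /andP[/eqP eu ux] /andP[/eqP fx _]].
rewrite /acyclic !all_cat /= => /and3P[_ /andP[/negP[]]].
by apply/cyclicP; exists e, p2; rewrite /= eqxx ef fx.
Qed.

Lemma acyclic_split p : exists p1 p2,
  [/\ p = p1 ++ p2, acyclic p1 & if p2 is e :: _ then cyclic (s e) else true].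
Proof.
elim: p => [|e p [p1 [p2 [-> ap1 cp2]]]]; first by exists [::], [::].
have [ce|ce] := boolP (cyclic (s e)); first by exists [::], (e :: p1 ++ p2).
by exists (e :: p1), p2; split=> //=; rewrite ce.
Qed.

Lemma acyclic_from_cyclic v p w : cyclic v -> walk v p w -> acyclic p ->
  p = [::].
Proof. by case: p => //= e p cv /andP[/eqP -> _] /andP[/negP[]]. Qed.

Section NoExit.
Hypothesis noexit : no_exit s r.

Lemma cyclic_source_inj e f : cyclic (s e) -> s f = s e -> f = e.
Proof.
move=> /asboolP /noexit[g [_ gP]] ef.
by rewrite (gP e) // (gP f).
Qed.

Lemma cyclic_range e : cyclic (s e) -> cyclic (r e).
Proof.
move=> ce; have /cyclicP[f [p /andP[/eqP fe fp]]] := ce.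
rewrite (cyclic_source_inj ce fe) in fp; apply/cyclicP.
case: p fp => [/eqP re|g p gp]; first by exists e, [::]; rewrite /= re !eqxx.
by exists g, (rcons p e); rewrite -rcons_cons walk_rcons eqxx andbT.
Qed.

Lemma cyclic_walk v p w : walk v p w -> cyclic v -> cyclic w.
Proof.
elim: p v => [|e p IHp] v /=; first by move=> /eqP ->.
by case/andP=> /eqP <- /IHp{}IHp /cyclic_range.
Qed.

Lemma cyclic_walk_unique v p q w w' : cyclic v ->
  walk v p w -> walk v q w' -> size p = size q -> p = q.
Proof.
elim: p q v => [|e p IHp] [|f q] v //= cv /andP[/eqP ev ep].
move=> /andP[/eqP fv fq] [].
rewrite -ev in cv fv; rewrite (cyclic_source_inj cv fv) in fq *.
by move=> /(IHp _ _ (cyclic_range cv) ep fq) ->.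
Qed.

(* Two closed walks at [r e], ending in [e] and [f], have equal powers. *)
Lemma cyclic_range_inj e f :
  cyclic (s e) -> cyclic (s f) -> r e = r f -> e = f.
Proof.
move=> ce cf ef.
have closed g : cyclic (s g) -> exists p, walk (r g) (rcons p g) (r g).
  move=> cg; have /cyclicP[h [p /andP[/eqP hg hp]]] := cg.
  rewrite (cyclic_source_inj cg hg) in hp.
  by exists p; rewrite walk_rcons eqxx andbT.
have [p pe] := closed e ce; have [q qf] := closed f cf.
rewrite -ef in qf.
have p_power := walk_flatten_nseq (size q).+1 pe.
have q_power := walk_flatten_nseq (size p).+1 qf.
have := cyclic_walk_unique (cyclic_range ce) p_power q_power.
rewrite !size_flatten /shape !map_nseq !sumn_nseq !size_rcons mulnC.
move=> /(_ erefl).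
rewrite -![in nseq _.+1 _]addn1 !nseqD !flatten_cat /= !cats0.
by rewrite -!rcons_cat => /rcons_inj[].
Qed.

Lemma acyclic_rcons v p e w :
  walk v (rcons p e) w -> ~~ cyclic (s e) -> acyclic (rcons p e).
Proof.
elim: p v => [|f p IHp] v /=; first by rewrite andbT.
case/andP=> _ fp ce; rewrite -/(acyclic (rcons p e)) (IHp _ fp ce) andbT.
apply: contra ce => /cyclic_range.
by move: fp; rewrite walk_rcons => /andP[fp _]; apply: cyclic_walk fp.
Qed.

Lemma cyclic_walk_rcons v p e : walk v p (r e) -> ~~ acyclic p ->
  cyclic (s e) -> exists q, p = rcons q e.
Proof.
case/lastP: p => // q f qe qc ce; exists q.
have /andP[_ /eqP fe] : walk v q (s f) && (r f == r e) by rewrite -walk_rcons.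
rewrite (cyclic_range_inj _ ce fe) //.
by apply: contraR qc; apply: acyclic_rcons qe.
Qed.

End NoExit.
End Walks.

(** * Paths in the algebra *)

Section PathElements.
Variables (K : fieldType) (V Ed : eqType) (s r : Ed -> V).
Implicit Types (v w : V) (e f : Ed) (p q : seq Ed).

Local Notation vertex := (vertex K s r).
Local Notation edge := (edge K s r).
Local Notation ghost := (ghost K s r).
Local Notation walk := (walk s r).
Local Infix "**" := (@lpa_mul K V Ed s r) (at level 40, left associativity).

Fixpoint real_path v p : lpa K s r :=
  if p is e :: p' then edge e ** real_path (r e) p' else vertex v.

Fixpoint ghost_path v p : lpa K s r :=
  if p is e :: p' then ghost_path (r e) p' ** ghost e else vertex v.

Lemma source_real_path v p w :
  walk v p w -> vertex v ** real_path v p = real_path v p.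
Proof.
case: p => [|e p] /=; first by rewrite vertex_idem.
by case/andP=> /eqP <- _; rewrite lpa_mulA source_edge.
Qed.

Lemma ghost_path_source v p w :
  walk v p w -> ghost_path v p ** vertex v = ghost_path v p.
Proof.
case: p => [|e p] /=; first by rewrite vertex_idem.
by case/andP=> /eqP <- _; rewrite -lpa_mulA ghost_source.
Qed.

Lemma range_ghost_path v p w :
  walk v p w -> vertex w ** ghost_path v p = ghost_path v p.
Proof.
elim: p v => [|e p IHp] v /=; first by move=> /eqP ->; rewrite vertex_idem.
by case/andP=> _ /IHp ep; rewrite lpa_mulA ep.
Qed.

Lemma ghost_path_rcons v p e :
  walk v p (s e) -> ghost_path v (rcons p e) = ghost e ** ghost_path v p.
Proof.
elim: p v => [|f p IHp] v /=.
  by move=> /eqP ->; rewrite range_ghost ghost_source.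
by case/andP=> _ /IHp ->; rewrite lpa_mulA.
Qed.

Lemma ghost_real_path v p w :
  walk v p w -> ghost_path v p ** real_path v p = vertex w.
Proof.
elim: p v => [|e p IHp] v /=; first by move=> /eqP ->; rewrite vertex_idem.
case/andP=> _ ep; rewrite -lpa_mulA (lpa_mulA (ghost e)) ghost_edge.
by rewrite (source_real_path ep) IHp.
Qed.

Lemma lpa_star_ghost_path (sigma : {rmorphism K -> K}) v p :
  lpa_star sigma (ghost_path v p) = real_path v p.
Proof.
elim: p v => [|e p IHp] v /=; first exact: lpa_star_vertex.
by rewrite lpa_starM lpa_star_ghost IHp.
Qed.

Lemma edge_ghost_path_rcons e v p : no_exit s r -> cyclic s r (s e) ->
  walk v p (s e) -> edge e ** ghost_path v (rcons p e) = ghost_path v p.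
Proof.
move=> noexit ce pe; rewrite (ghost_path_rcons pe) lpa_mulA edge_ghost.
  exact: range_ghost_path pe.
by move=> f; apply: cyclic_source_inj noexit _ _ ce.
Qed.

End PathElements.

Lemma star_finite_no_exit (K : fieldType) (sigma : {rmorphism K -> K})
    (V Ed : choiceType) (s r : Ed -> V) :
  star_finite (@lpa_mul K V Ed s r) (lpa_star sigma) -> no_exit s r.
Proof.
move=> fin v /on_cycle_closed_walk[e [p vpv]]; exists e.
have /andP[/eqP ev _] := vpv; split=> // f fv.
have cc : lpa_mul (real_path K s r v (e :: p)) (ghost_path K s r v (e :: p)) =
          vertex K s r v.
  rewrite -(lpa_star_ghost_path s r sigma); apply: fin.
  - exact: vertex_idem.
  - by split; [apply: range_ghost_path vpv|apply: ghost_path_source vpv].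
  - by rewrite lpa_star_ghost_path (ghost_real_path K vpv).
apply: contrapT => fe; have /eqP[] := vertex_neq0 K s r (r f).
rewrite -ghost_edge -ghost_source fv -cc /= !lpa_mulA ghost_edge_orth //.
by rewrite !linear0l.
Qed.

(** * Linear growth *)

Section Monomials.
Variables (K : fieldType) (V Ed : eqType) (s r : Ed -> V).
Implicit Types (v w : V) (e f : Ed) (p q : seq Ed).

Local Notation L := (lpa K s r).
Local Notation vertex := (vertex K s r).
Local Notation edge := (edge K s r).
Local Notation ghost := (ghost K s r).
Local Notation real_path := (real_path K s r).
Local Notation ghost_path := (ghost_path K s r).
Local Notation walk := (walk s r).
Local Notation cyclic := (cyclic s r).
Local Notation acyclic := (acyclic s r).
Local Infix "**" := (@lpa_mul K V Ed s r) (at level 40, left associativity).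

Definition vertices (W : seq V) (F : seq Ed) : seq V := W ++ map s F ++ map r F.

Lemma source_vertices W F e : e \in F -> s e \in vertices W F.
Proof. by move=> eF; rewrite !mem_cat map_f ?orbT. Qed.

Lemma range_vertices W F e : e \in F -> r e \in vertices W F.
Proof. by move=> eF; rewrite !mem_cat [r e \in map r F]map_f ?orbT. Qed.

(* If two paths end in a common edge [e] on a cycle, it can be cancelled because
   [e e^* = s(e)]; hence the restriction to pairs with an acyclic member. *)
Inductive monomial (W : seq V) (F : seq Ed) (n : nat) : L -> Prop :=
  Monomial v p w q y of
    walk v p y & walk w q y & acyclic p || acyclic q &
    v \in vertices W F & w \in vertices W F &
    all (mem F) p & all (mem F) q & (size p + size q <= n)%N :
  monomial W F n (real_path v p ** ghost_path w q).

Lemma sub_monomial W W' F F' m n z :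
    {subset W <= W'} -> {subset F <= F'} -> (m <= n)%N ->
  monomial W F m z -> monomial W' F' n z.
Proof.
move=> sW sF mn [v p w q y vp wq apq vW wW pF qF pqm].
have sV : {subset vertices W F <= vertices W' F'}.
  move=> x; rewrite !mem_cat => /or3P[/sW->//||] /mapP[e /sF eF' ->];
    by rewrite map_f ?orbT.
apply: (Monomial vp wq apq); rewrite ?sV //; last exact: leq_trans pqm mn.
- by apply: sub_all pF => e /sF.
- by apply: sub_all qF => e /sF.
Qed.

Section Filtration.
Hypothesis noexit : no_exit s r.
Variables (W : seq V) (F : seq Ed).
Local Notation mono := (monomial W F).

Lemma monomial_leq m n z : (m <= n)%N -> mono m z -> mono n z.
Proof. exact: sub_monomial. Qed.

Lemma vertex_lspan_monomial n v z :
  lspan (mono n) z -> lspan (mono n) (vertex v ** z).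
Proof.
apply: lspan_linearr => {}z [v' p w q y vp wq apq vW wW pF qF pqn] /=.
rewrite -(source_real_path K vp) !lpa_mulA; have [->|/eqP vv'] := eqVneq v v'.
  rewrite vertex_idem (source_real_path K vp).
  exact/lspan_gen/(Monomial vp wq).
by rewrite vertex_orth // !linear0l; apply: lspan0.
Qed.

Lemma edge_lspan_monomial n e z : e \in F ->
  lspan (mono n) z -> lspan (mono n.+1) (edge e ** z).
Proof.
move=> eF; apply: lspan_linearr => {}z [v p w q y vp wq apq vW wW pF qF pqn] /=.
have [ev|/eqP ev] := eqVneq (r e) v; last first.
  rewrite -(source_real_path K vp) -edge_range !lpa_mulA.
  rewrite -(lpa_mulA (edge e)) vertex_orth // linear0r !linear0l.
  exact: lspan0.
rewrite -ev in vp *; rewrite lpa_mulA.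
have [aepq|] := boolP (acyclic (e :: p) || acyclic q).
  apply: lspan_gen; apply: (Monomial (v := s e) (p := e :: p) _ wq aepq) => //.
  - by rewrite /= eqxx.
  - exact: source_vertices.
  - by rewrite /= eF.
rewrite negb_or => /andP[aep aq]; rewrite (negbTE aq) orbF in apq.
have ce : cyclic (s e) by move: aep; rewrite /= -/(acyclic p) apq andbT negbK.
have p0 := acyclic_from_cyclic (cyclic_range noexit ce) vp apq.
rewrite {}p0 in vp pqn *; rewrite -(eqP vp) {y vp} in wq *.
have [q' Eq] := cyclic_walk_rcons noexit wq aq ce.
rewrite {}Eq walk_rcons all_rcons size_rcons in wq qF pqn *.
have /andP[{}wq _] := wq; have /andP[_ {}qF] := qF.
rewrite /= edge_range (edge_ghost_path_rcons K noexit ce wq).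
rewrite -(range_ghost_path K wq); apply: lspan_gen.
apply: (@Monomial _ _ _ (s e) [::]) wq _ _ _ _ _ _ => //=.
  exact: source_vertices.
by rewrite add0n ltnW // ltnW.
Qed.

Lemma ghost_lspan_monomial n e z : e \in F ->
  lspan (mono n) z -> lspan (mono n.+1) (ghost e ** z).
Proof.
move=> eF; apply: lspan_linearr => {}z [v p w q y vp wq apq vW wW pF qF pqn] /=.
have [ev|/eqP ev] := eqVneq (s e) v; last first.
  rewrite -(source_real_path K vp) -ghost_source !lpa_mulA.
  rewrite -(lpa_mulA (ghost e)) vertex_orth // linear0r !linear0l.
  exact: lspan0.
rewrite -ev in vp *; rewrite lpa_mulA; case: p => [|f p] /= in vp apq pF pqn *.
  rewrite -(eqP vp) in wq; rewrite ghost_source -range_ghost -lpa_mulA.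
  rewrite -ghost_path_rcons //; apply: lspan_gen.
  apply: (@Monomial _ _ _ (r e) [::] _ _ (r e)); rewrite //= ?eqxx //.
  - by rewrite walk_rcons wq eqxx.
  - exact: range_vertices.
  - by rewrite all_rcons /= eF.
  - by rewrite size_rcons.
case/andP: vp => _ fp; case/andP: pF => _ pF.
have [ef|/eqP ef] := eqVneq e f; last first.
  by rewrite lpa_mulA ghost_edge_orth // !linear0l; apply: lspan0.
rewrite -ef in fp *; rewrite lpa_mulA ghost_edge (source_real_path K fp).
apply/lspan_gen/(Monomial fp wq) => //.
- by case/orP: apq => [/andP[_ ->]|->]; rewrite ?orbT.
- exact: range_vertices.
- by rewrite ltnW // ltnW.
Qed.

Lemma real_path_lspan_monomial n v p z : all (mem F) p ->
  lspan (mono n) z -> lspan (mono (size p + n)) (real_path v p ** z).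
Proof.
move=> + nz; elim: p v => [|e p IHp] v /=.
  by move=> _; apply: vertex_lspan_monomial.
case/andP=> eF pF; rewrite -lpa_mulA.
exact/(edge_lspan_monomial eF)/IHp.
Qed.

Lemma ghost_path_lspan_monomial n v p z : all (mem F) p ->
  lspan (mono n) z -> lspan (mono (size p + n)) (ghost_path v p ** z).
Proof.
elim: p v n z => [|e p IHp] v n z /=.
  by move=> _; apply: vertex_lspan_monomial.
case/andP=> eF pF nz; rewrite -lpa_mulA addSnnS.
exact/IHp/(ghost_lspan_monomial eF).
Qed.

Lemma monomial_mul m n z t :
  mono m z -> mono n t -> lspan (mono (m + n)) (z ** t).
Proof.
case=> v p w q y _ _ _ _ _ pF qF pqm nt; rewrite -lpa_mulA.
apply: (lspan_leq monomial_leq (m := size p + (size q + n))).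
  by rewrite addnA leq_add2r.
apply: real_path_lspan_monomial => //.
by apply: ghost_path_lspan_monomial => //; apply: lspan_gen.
Qed.

End Filtration.

Lemma lspan_monomial_catl W W' F F' m n z :
  lspan (monomial W F m) z -> lspan (monomial (W ++ W') (F ++ F') (m + n)) z.
Proof.
apply: sub_lspan => t; apply: sub_monomial; last exact: leq_addr.
- exact/mem_subseq/prefix_subseq.
- exact/mem_subseq/prefix_subseq.
Qed.

Lemma lspan_monomial_catr W W' F F' m n z :
  lspan (monomial W' F' n) z -> lspan (monomial (W ++ W') (F ++ F') (m + n)) z.
Proof.
apply: sub_lspan => t; apply: sub_monomial; last exact: leq_addl.
- exact/mem_subseq/suffix_subseq.
- exact/mem_subseq/suffix_subseq.
Qed.

Lemma lspan_monomial_gen g :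
  exists W F n, lspan (monomial W F n) (lpa_of s r (tgen K g)).
Proof.
case: g => [v|e|e].
- exists [:: v], [::], 0%N; apply: lspan_gen.
  rewrite -/(vertex v) -vertex_idem.
  by apply: (@Monomial _ _ _ v [::] v [::] v); rewrite /= ?mem_head.
- exists [::], [:: e], 1%N; apply: lspan_gen.
  rewrite -/(edge e) -2!edge_range.
  by apply: (@Monomial _ _ _ (s e) [:: e] (r e) [::] (r e));
    rewrite /= ?inE ?eqxx ?orbT.
- exists [::], [:: e], 1%N; apply: lspan_gen.
  rewrite -/(ghost e) -2!range_ghost.
  by apply: (@Monomial _ _ _ (r e) [::] (s e) [:: e] (r e));
    rewrite /= ?inE ?eqxx ?orbT.
Qed.

Lemma lpa_lspan_monomial (z : L) : no_exit s r ->
  exists W F n, lspan (monomial W F n) z.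
Proof.
move=> noexit; elim/lpa_ind: z.
elim=> [g||x [W [F [m mx]]] y [W' [F' [n ny]]]|a x [W [F [n nx]]]
       |x [W [F [m mx]]] y [W' [F' [n ny]]]].
- exact: lspan_monomial_gen.
- by exists [::], [::], 0%N; rewrite lpa_of0; apply: lspan0.
- exists (W ++ W'), (F ++ F'), (m + n)%N; rewrite lpa_ofD.
  by apply: lspanD; [apply: lspan_monomial_catl|apply: lspan_monomial_catr].
- by exists W, F, n; rewrite lpa_ofZ; apply: lspanZ.
- exists (W ++ W'), (F ++ F'), ((m + n) + (m + n))%N; rewrite lpa_ofM.
  apply: lspan_mul; first exact: monomial_mul.
    exact: lspan_monomial_catl.
  exact: lspan_monomial_catr.
Qed.

End Monomials.

Section LinearGrowth.
Variables (K : fieldType) (V Ed : choiceType) (s r : Ed -> V).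
Hypothesis noexit : no_exit s r.
Variables (W : seq V) (F : seq Ed).
Implicit Types (v w : V) (e f : Ed) (p q : seq Ed).

Local Notation walk := (walk s r).
Local Notation cyclic := (cyclic s r).
Local Notation acyclic := (acyclic s r).

Fixpoint words n : seq (seq Ed) :=
  if n is n'.+1 then [::] :: [seq e :: p | e <- F, p <- words n']
  else [:: [::]].

Lemma mem_words n p : all (mem F) p -> (size p <= n)%N -> p \in words n.
Proof.
elim: n p => [|n IHn] [|e p] //= /andP[eF pF] pn.
by rewrite inE /=; apply/allpairsP; exists (e, p); split; rewrite ?IHn.
Qed.

Definition next_edge e : Ed := xget e (fun f => s f = r e).

Lemma cyclic_walk_traject e p w : cyclic (s e) -> walk (r e) p w ->
  e :: p = traject next_edge e (size p).+1.
Proof.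
elim: p e => [|f p IHp] e ce //= /andP[/eqP fe fp].
have -> : next_edge e = f.
  have cf : cyclic (s f) by rewrite fe; apply: cyclic_range.
  apply: (cyclic_source_inj noexit cf); rewrite fe.
  exact: (xgetI (P := fun g => s g = r e) e fe).
by rewrite {1}(IHp f) // fe; apply: cyclic_range.
Qed.

Definition acyclic_words : seq (seq Ed) := words (size F).

Definition walk_words n : seq (seq Ed) := acyclic_words ++
  [seq p ++ q | p <- acyclic_words,
                q <- [seq traject next_edge e k | e <- F, k <- iota 0 n.+1]].

Lemma mem_acyclic_words v p w :
  walk v p w -> acyclic p -> all (mem F) p -> p \in acyclic_words.
Proof.
move=> vpw ap pF; apply: mem_words => //.
by apply: uniq_leq_size (allP pF); apply: acyclic_uniq vpw ap.
Qed.

Lemma mem_walk_words n v p w :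
  walk v p w -> all (mem F) p -> (size p <= n)%N -> p \in walk_words n.
Proof.
move=> + + pn; have [p1 [p2 [Ep ap1 cp2]]] := acyclic_split s r p.
rewrite Ep all_cat => /walk_catP[u vu uw] /andP[p1F p2F].
have p1_acyclic := mem_acyclic_words vu ap1 p1F; rewrite mem_cat.
case: p2 cp2 uw p2F Ep => [|e p2] ce uw p2F Ep.
  by rewrite cats0 p1_acyclic.
apply/orP; right; apply/allpairsP; exists (p1, e :: p2); split=> //.
case/andP: uw => _ uw; case/andP: p2F => eF _.
apply/allpairsP; exists (e, (size p2).+1); split=> //.
  by rewrite mem_iota /= add0n ltnS (leq_trans _ pn) // Ep size_cat /= leq_addl.
exact: cyclic_walk_traject uw.
Qed.

Lemma size_walk_words n :
  (size (walk_words n) <= size acyclic_words * (size F).+1 * n.+1)%N.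
Proof. by rewrite size_cat !size_allpairs size_iota; nia. Qed.

Definition monomials n : seq (lpa K s r) :=
  [seq lpa_mul (real_path K s r vw.1 pq.1) (ghost_path K s r vw.2 pq.2)
    | vw <- [seq (v, w) | v <- vertices s r W F, w <- vertices s r W F],
      pq <- [seq (p, q) | p <- acyclic_words, q <- walk_words n] ++
            [seq (p, q) | p <- walk_words n, q <- acyclic_words]].

Lemma mem_monomials n z : monomial W F n z -> z \in monomials n.
Proof.
case=> v p w q y vp wq apq vW wW pF qF pqn.
apply/allpairsP; exists ((v, w), (p, q)); split=> //=.
  by apply/allpairsP; exists (v, w).
have pn := leq_trans (leq_addr _ _) pqn.
have qn := leq_trans (leq_addl _ _) pqn.
rewrite mem_cat; apply/orP; case/orP: apq => [ap|aq]; [left|right].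
- apply/allpairsP; exists (p, q).
  by rewrite (mem_acyclic_words vp) ?(mem_walk_words wq).
- apply/allpairsP; exists (p, q).
  by rewrite (mem_walk_words vp) ?(mem_acyclic_words wq).
Qed.

Lemma monomial_linear_growth : linear_growth (@monomial K V Ed s r W F).
Proof.
pose A := size acyclic_words; pose X := size (vertices s r W F).
exists ((X * X) * (2 * A * (A * (size F).+1)))%N => n.
exists (monomials n); split; last first.
  by move=> z /mem_monomials; apply: lspan_gen.
rewrite !size_allpairs -/X size_cat !size_allpairs -/A -[leqRHS]mulnA.
by rewrite leq_mul //; have := size_walk_words n; rewrite -/A; nia.
Qed.

End LinearGrowth.

Lemma no_exit_directly_finite (K : fieldType) (V Ed : choiceType)
  (s r : Ed -> V) : no_exit s r -> directly_finite (@lpa_mul K V Ed s r).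
Proof.
move=> noexit x y u uu u_x u_y xy.
have [Wx [Fx [k kx]]] := lpa_lspan_monomial x noexit.
have [Wy [Fy [m my]]] := lpa_lspan_monomial y noexit.
have [Wu [Fu [n nu]]] := lpa_lspan_monomial u noexit.
pose W := Wx ++ Wy ++ Wu; pose F := Fx ++ Fy ++ Fu.
have growth := monomial_linear_growth K noexit W F.
apply: (subquadratic_growth_mulC (@lpa_mulA K V Ed s r) uu u_x u_y xy
  (@monomial_leq K V Ed s r W F) (@monomial_mul K V Ed s r noexit W F)
  (n := (k + (m + n))%N)).
- exact: linear_growth_subquadratic growth.
- exact: lspan_monomial_catl.
- exact/lspan_monomial_catr/lspan_monomial_catl.
- exact/lspan_monomial_catr/lspan_monomial_catr.
Qed.

Theorem theorem4p12 (K : fieldType) (sigma : {rmorphism K -> K})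
  (Hsigma : involutive sigma) (V Ed : Type) (s r : Ed -> V) :
  (@lpa_directly_finite K V Ed s r <-> lpa_finite sigma s r) /\
  (lpa_finite sigma s r <-> no_exit s r).
Proof.
rewrite lpa_directly_finiteE lpa_finiteE.
have df_f := directly_finite_star_finite
  (lpa_starK (s := s) (r := r) Hsigma) (lpa_starM (s := s) (r := r) sigma).
have f_ne := @star_finite_no_exit K sigma {classic V} {classic Ed} s r.
have ne_df := @no_exit_directly_finite K {classic V} {classic Ed} s r.
by split; split=> // ?; [apply/ne_df/f_ne|apply/df_f/ne_df].
Qed.
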